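(* Let $\kappa>0$, $\rho>0$, $\delta>0$ and $0<\alpha<1$, and for $\xi>0$ let $$\omega(\xi)=\left(\frac{8\pi\kappa}{\rho\,\delta^{2\alpha}}\int_0^1\frac{1-j_0(\xi\delta z)}{z^{1+2\alpha}}\,dz\right)^{1/2},$$ where $j_0(x):=\frac{\sin x}{x}$. Then $$\lim_{\xi\to0}\xi^{-2}\omega^2(\xi)=\frac{2\pi\kappa\,\delta^{2(1-\alpha)}}{3(1-\alpha)\,\rho}$$ and $$\lim_{\xi\to\infty}\xi^{-2\alpha}\omega^2(\xi)=\frac{8\pi\kappa}{\rho}\int_0^\infty\frac{1-j_0(\tau)}{\tau^{1+2\alpha}}\,d\tau.$$
   Context: The function $j_0$ is the $0$-th order spherical Bessel function of the first kind, with $j_0(0)=1$. The function $\omega$ is the dispersion relation of the three-dimensional linear peridynamic equation. *)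

(* Defs.v *)
From HB Require Import structures.
From mathcomp Require Import all_boot all_order all_algebra.
From mathcomp Require Import all_classical all_reals all_analysis.

Set Implicit Arguments.
Unset Strict Implicit.
Unset Printing Implicit Defensive.

Import Order.TTheory GRing.Theory Num.Theory.
Import numFieldNormedType.Exports.

Local Open Scope classical_set_scope.
Local Open Scope ring_scope.

Definition j0 (R : realType) (x : R) : R := if x == 0 then 1 else sin x / x.

(* The integrand is nonnegative and, when 1/2 < alpha, unbounded near 0; the
   improper integral is read as a Lebesgue integral, and 0 is left out of the
   domain so that no division by zero occurs. *)
Definition omega (R : realType) (kappa rho delta alpha xi : R) : R :=
  Num.sqrt
    (8 * pi * kappa / (rho * delta `^ (2 * alpha)) *
     \int[lebesgue_measure]_(z in `]0, 1])
        ((1 - j0 (xi * delta * z)) / z `^ (1 + 2 * alpha))).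

(* Main.v *)
Require Import Defs.
From HB Require Import structures.
From mathcomp Require Import all_boot all_order all_algebra.
From mathcomp Require Import all_classical all_reals all_analysis.
From mathcomp Require Import measurable_realfun ring lra.

Set Implicit Arguments.
Unset Strict Implicit.
Unset Printing Implicit Defensive.

Import Order.TTheory GRing.Theory Num.Theory.
Import numFieldNormedType.Exports.

Local Open Scope classical_set_scope.
Local Open Scope ring_scope.

(* Comparing sin with its Taylor polynomials gives
   x^2/6 - x^4/120 <= 1 - j0 x <= x^2/6 for x > 0.  Integrating against
   z^-(1+2alpha) over ]0, 1] and dividing by xi^2, the quartic term is O(xi^2),
   which yields the first limit.  For the second, put c = xi delta: the
   substitution tau = c z turns the integral over ]0, 1] into c^(2alpha) times
   the integral of (1 - j0 tau) / tau^(1+2alpha) over ]0, c], and since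
   1 - j0 <= 2 the missing tail over ]c, +oo[ is at most c^(-2alpha) / alpha. *)

(** * Taylor bounds for sine and cosine on the half-line, and the bounds on 1 - j0 *)

Lemma ge0_of_derive_ge0 (R : realType) (f df : R -> R) :
  f 0 = 0 -> (forall x : R, is_derive x 1 f (df x)) ->
  (forall x, 0 <= x -> 0 <= df x) -> forall x, 0 <= x -> 0 <= f x.
Proof.
move=> f0 dfE df0 x x0.
have fd y : derivable f y 1 by apply: ex_derive.
have cf : {within `[0, x], continuous f}.
  by apply: derivable_within_continuous => y _.
have [c + fE] := MVT_segment x0 (fun y _ => dfE y) cf.
rewrite in_itv/= => /andP[c0 _].
by move: fE; rewrite f0 !subr0 => ->; rewrite mulr_ge0// df0.
Qed.

Section taylor_bounds.
Variable R : realType.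
Implicit Types x : R.

(** Start of a chain ending in [sin_le_taylor5]: at each stage the difference of the two sides
    vanishes at 0 and has the previous difference as its derivative. Here that derivative is 1 -
    cos, which is nonnegative. *)
Lemma sin_le_id x : 0 <= x -> sin x <= x.
Proof.
move=> x0; rewrite -subr_ge0.
apply: (@ge0_of_derive_ge0 _ (fun y => y - sin y) (fun y => 1 - cos y)) => //.
by rewrite sin0 subr0.
Qed.

Lemma cos_ge_taylor2 x : 0 <= x -> 1 - x ^+ 2 / 2 <= cos x.
Proof.
move=> x0; rewrite -subr_ge0.
apply: (@ge0_of_derive_ge0 _ (fun y => cos y - (1 - y ^+ 2 / 2))
  (fun y => y - sin y)) => //.
- by rewrite cos0; lra.
- by move=> y; apply: is_derive_eq; rewrite /GRing.scale/=; lra.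
- by move=> y y0; rewrite subr_ge0 sin_le_id.
Qed.

Lemma sin_ge_taylor3 x : 0 <= x -> x - x ^+ 3 / 6 <= sin x.
Proof.
move=> x0; rewrite -subr_ge0.
apply: (@ge0_of_derive_ge0 _ (fun y => sin y - (y - y ^+ 3 / 6))
  (fun y => cos y - (1 - y ^+ 2 / 2))) => //.
- by rewrite sin0; lra.
- by move=> y; apply: is_derive_eq; rewrite /GRing.scale/=; lra.
- by move=> y y0; rewrite subr_ge0 cos_ge_taylor2.
Qed.

Lemma cos_le_taylor4 x : 0 <= x -> cos x <= 1 - x ^+ 2 / 2 + x ^+ 4 / 24.
Proof.
move=> x0; rewrite -subr_ge0.
apply: (@ge0_of_derive_ge0 _ (fun y => 1 - y ^+ 2 / 2 + y ^+ 4 / 24 - cos y)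
  (fun y => sin y - (y - y ^+ 3 / 6))) => //.
- by rewrite cos0; lra.
- by move=> y; apply: is_derive_eq; rewrite /GRing.scale/=; lra.
- by move=> y y0; rewrite subr_ge0 sin_ge_taylor3.
Qed.

Lemma sin_le_taylor5 x : 0 <= x -> sin x <= x - x ^+ 3 / 6 + x ^+ 5 / 120.
Proof.
move=> x0; rewrite -subr_ge0.
apply: (@ge0_of_derive_ge0 _ (fun y => y - y ^+ 3 / 6 + y ^+ 5 / 120 - sin y)
  (fun y => 1 - y ^+ 2 / 2 + y ^+ 4 / 24 - cos y)) => //.
- by rewrite sin0; lra.
- by move=> y; apply: is_derive_eq; rewrite /GRing.scale/=; lra.
- by move=> y y0; rewrite subr_ge0 cos_le_taylor4.
Qed.

Lemma onem_j0_le x : 0 < x -> 1 - j0 x <= x ^+ 2 / 6.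
Proof.
move=> x0; rewrite /j0 gt_eqF// lerBlDr -lerBlDl ler_pdivlMr//.
by have := sin_ge_taylor3 (ltW x0); lra.
Qed.

Lemma onem_j0_ge x : 0 < x -> x ^+ 2 / 6 - x ^+ 4 / 120 <= 1 - j0 x.
Proof.
move=> x0; rewrite /j0 gt_eqF// lerBrDr -lerBrDl ler_pdivrMr//.
by have := sin_le_taylor5 (ltW x0); lra.
Qed.

Lemma onem_j0_ge0 x : 0 < x -> 0 <= 1 - j0 x.
Proof.
by move=> x0; rewrite /j0 gt_eqF// subr_ge0 ler_pdivrMr// mul1r sin_le_id ?ltW.
Qed.

Lemma onem_j0_le2 x : 0 < x -> 1 - j0 x <= 2.
Proof.
move=> x0; rewrite /j0 gt_eqF// lerBlDr -lerBlDl ler_pdivlMr//.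
(* The goal is now -x <= sin x. If x >= 1 it follows from sin x >= -1; if x < 1 the cubic bound x -
   x^3/6 is already at least -x. *)
have := sin_geN1 x; have [x1|x1] := leP 1 x; first by lra.
by have := sin_ge_taylor3 (ltW x0); nra.
Qed.

End taylor_bounds.

(** * Change of variables for the Lebesgue measure under a dilation *)

Section lebesgue_scale.
Context {R : realType}.
Local Open Scope ereal_scope.
Notation mu := (@lebesgue_measure R).

(** The dilation pulls ]a, b] back to ]a/c, b/c], so c times the pushforward gives every half-open
    interval its length; uniqueness of the Lebesgue measure extends this to all measurable sets. *)
Lemma pushforward_lebesgue_measureZ (c : R) (A : set R) : (0 < c)%R ->
  measurable A ->
  pushforward mu ( *%R c : measurableTypeR R -> measurableTypeR R) A =
  c^-1%:E * mu A.
Proof.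
move=> c0 mA.
have c0' : (0 <= c)%R by exact: ltW.
suff -> : mu A = pushforward (mscale (NngNum c0') mu)
    ( *%R c : measurableTypeR R -> measurableTypeR R) A.
  by rewrite /mscale/= muleA -EFinM mulVf ?gt_eqF// mul1e.
apply: lebesgue_measure_unique => //= _ [[a b]] _ <-.
rewrite /pushforward /mscale/=.
have -> : ( *%R c @^-1` `]a, b] = `](a / c)%R, (b / c)%R])%classic.
  apply/seteqP; split => x/=; rewrite !in_itv/= ltr_pdivrMr// ler_pdivlMr//.
  - by rewrite mulrC.
  - by rewrite mulrC.
rewrite !lebesgue_measure_itv/= !lte_fin ltr_pM2r ?invr_gt0//.
case: ifPn => _; last by rewrite mule0.
by rewrite -!EFinB -mulrBl -EFinM mulrC divfK ?gt_eqF.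
Qed.

(** The left side is the integral of [f] against the pushforward of [mu] under the dilation, which
    is [mu] scaled by 1/c. *)
Lemma ge0_integral_scale (c : R) (D : set R) (f : R -> \bar R) : (0 < c)%R ->
  measurable D -> measurable_fun D f -> (forall x, D x -> 0 <= f x) ->
  \int[mu]_(x in *%R c @^-1` D) f (c * x)%R = c^-1%:E * \int[mu]_(x in D) f x.
Proof.
move=> c0 mD mf f0.
have c0' : (0 <= c^-1)%R by rewrite invr_ge0 ltW.
have mc : measurable_fun [set: measurableTypeR R]
    ( *%R c : measurableTypeR R -> measurableTypeR R).
  exact: mulrl_measurable.
rewrite -[RHS](ge0_integral_mscale mu mD (NngNum c0'))//.
rewrite -(@ge0_integral_pushforward _ _ _ _ _ _ mc)//.
  apply: eq_measure_integral => A mA _; rewrite /mscale/=.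
  exact: pushforward_lebesgue_measureZ.
by move=> x /set_mem; exact: f0.
Qed.

End lebesgue_scale.

(** * Exact integrals of powers near 0 and at infinity *)

Section powR_integral.
Context {R : realType}.
Notation mu := (@lebesgue_measure R).
Implicit Types a p x : R.

Lemma powRN_cvgy p : 0 < p -> x `^ (- p) @[x --> +oo] --> (0 : R).
Proof.
move=> p0; apply/cvgrPdist_le => e e0; near=> x.
(* The threshold is the point where x^(-p) equals [e]. *)
have x_ge : e^-1 `^ p^-1 <= x by near: x; exact: nbhs_pinfty_ge.
have x_gt0 : 0 < x by rewrite (lt_le_trans _ x_ge)// powR_gt0// invr_gt0.
rewrite sub0r normrN ger0_norm ?powR_ge0// powRN.
rewrite -[leRHS]invrK lef_pV2 ?posrE ?invr_gt0 ?powR_gt0//.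
have -> : e^-1 = (e^-1 `^ p^-1) `^ p.
  by rewrite -powRrM mulVf ?gt_eqF// powRr1// invr_ge0 ltW.
by apply: ge0_ler_powR => //; rewrite ?nnegrE ?powR_ge0 ?ltW//.
Unshelve. all: by end_near. Qed.

Lemma is_derive_powR_primitive p x : p != 0 -> 0 < x ->
  is_derive x 1 (fun y => y `^ p / p) (x `^ (p - 1)).
Proof.
move=> p0 x0; have dpowR := is_derive1_powR p x0.
apply: is_derive_eq; by rewrite scaler0 add0r /GRing.scale/= mulrA mulVf// mul1r.
Qed.

Lemma integral_powR_itvcy p a : 0 < p -> 0 < a ->
  (\int[mu]_(x in `[a, +oo[) (x `^ (- p - 1))%:E = (a `^ (- p) / p)%:E)%E.
Proof.
move=> p0 a0.
have pN0 : - p != 0 by rewrite oppr_eq0 gt_eqF.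
have dF x : a <= x -> is_derive x 1 (fun y => y `^ (- p) / - p) (x `^ (- p - 1)).
  by move=> ax; apply: is_derive_powR_primitive => //; exact: lt_le_trans ax.
(* The argument [0] is the limit of the primitive at infinity, so the integral is minus the value of
   the primitive at [a]. *)
rewrite (@ge0_continuous_FTC2y _ _ (fun y => y `^ (- p) / - p) _ 0).
- by rewrite sub0e -EFinN invrN mulrN opprK.
- by move=> x _; exact: powR_ge0.
- apply: derivable_within_continuous => x; rewrite in_itv/= andbT => ax.
  by apply: derivable_powR; rewrite in_itv/= andbT (lt_le_trans a0).
- rewrite -[X in _ --> X](mul0r (- p)^-1).
  by apply: cvgMr_tmp; exact: powRN_cvgy.
- by move=> x /ltW/dF[].
- have : derivable (fun y => y `^ (- p) / - p) a 1 by have [] := dF a (lexx a).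
  move=> /derivable1_diffP/differentiable_continuous.
  exact: cvg_at_right_filter.
- move=> x; rewrite in_itv/= andbT => /ltW/dF[dx <-].
  by rewrite derive1E.
Qed.

Lemma integral_powR_itvcc p a : 0 < p -> 0 < a <= 1 ->
  (\int[mu]_(x in `[a, 1%R]) (x `^ (p - 1))%:E = (p^-1 - a `^ p / p)%:E)%E.
Proof.
(* The one-point interval [a = 1] is settled apart from the fundamental theorem of calculus; it
   occurs as the first term of the exhausting sequence in [integral_powR_itvoc]. *)
move=> p0 /andP[a0]; rewrite le_eqVlt => /predU1P[->|a1].
  by rewrite set_itv1 integral_set1 powR1 mul1r subrr.
have pn0 : p != 0 by rewrite gt_eqF.
have dF x : a <= x -> is_derive x 1 (fun y => y `^ p / p) (x `^ (p - 1)).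
  by move=> ax; apply: is_derive_powR_primitive => //; exact: lt_le_trans ax.
rewrite (@continuous_FTC2 _ _ (fun y => y `^ p / p))//.
- by rewrite powR1 mul1r.
- apply: derivable_within_continuous => x; rewrite in_itv/= => /andP[ax _].
  by apply: derivable_powR; rewrite in_itv/= andbT (lt_le_trans a0).
- have Fcont x : a <= x -> {for x, continuous (fun y => y `^ p / p)}.
    move=> /dF[+ _].
    by move=> /derivable1_diffP/differentiable_continuous.
  split.
  + by move=> x; rewrite in_itv/= => /andP[/ltW/dF[]].
  + exact/cvg_at_right_filter/Fcont.
  + exact/cvg_at_left_filter/Fcont/ltW.
- move=> x; rewrite in_itv/= => /andP[/ltW/dF[dx <-] _].
  by rewrite derive1E.
Qed.

(** For p < 1 the integrand blows up at 0, so ]0, 1] is exhausted by the intervals [1/(n+1), 1] and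
    monotone convergence is applied; the boundary term a^p / p vanishes in the limit because p >
    0. *)
Lemma integral_powR_itvoc p : 0 < p ->
  (\int[mu]_(x in `]0%R, 1%R]) (x `^ (p - 1))%:E = p^-1%:E)%E.
Proof.
move=> p0; rewrite itv_open_bnd_bigcup.
pose a n : R := 0 + n.+1%:R^-1.
have a01 n : 0 < a n <= 1.
  by rewrite /a !add0r invr_gt0 ltr0n invf_le1 ?ltr0n ?ler1n.
pose F n : set (measurableTypeR R) := `[a n, 1]%classic.
have := @ge0_nondecreasing_set_cvg_integral _ _ _ F
  (fun x => (x `^ (p - 1))%:E) mu.
under eq_cvg do rewrite integral_powR_itvcc//.
move=> cvgI; apply/esym/(cvg_unique _ _ (cvgI _ _ _ _)) => //.
- apply: cvg_EFin; first exact: nearW.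
  rewrite -[X in _ --> X]subr0; apply: cvgB; first exact: cvg_cst.
  rewrite -(mul0r p^-1); apply: cvgMr_tmp => /=.
  have /cvg_at_rightP := powR_cvg0 p0.
  apply; split.
  + by move=> n; have /andP[] := a01 n.
  + under eq_cvg do rewrite /a add0r.
    exact: cvg_harmonic.
- apply/nondecreasing_seqP => n; rewrite subsetEset; apply: subset_itvr.
  by rewrite bnd_simp lerD2l lef_pV2 ?posrE ?ltr0n// ler_nat.
- by move=> n; exact: measurable_itv.
- by move=> n; apply/measurable_EFinP; apply: measurable_funTS; exact: measurable_powR.
- by move=> n x _; rewrite lee_fin powR_ge0.
Qed.

End powR_integral.

(** Serves to glue integrability near 0 to integrability at infinity; the integral of |f| is
    additive over disjoint sets. *)
Lemma integrable_setU d (T : measurableType d) (R : realType)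
    (mu : {measure set T -> \bar R}) (A B : set T) (f : T -> \bar R) :
  measurable A -> measurable B -> [disjoint A & B] ->
  mu.-integrable A f -> mu.-integrable B f -> mu.-integrable (A `|` B) f.
Proof.
move=> mA mB AB /integrableP[mfA fAoo] /integrableP[mfB fBoo].
have mf : measurable_fun (A `|` B) f by exact/measurable_funU.
apply/integrableP; split => //; rewrite ge0_integral_setU//.
  by rewrite lte_add_pinfty.
exact: measurableT_comp.
Qed.

(** * Powers as integrable dominating functions, with real-valued integrals *)

Section powR_integrable.
Context {R : realType}.
Notation mu := (@lebesgue_measure R).
Implicit Types a p : R.

Lemma integrable_powR_itvoc p : 0 < p ->
  mu.-integrable `]0, 1] (fun x => (x `^ (p - 1))%:E).
Proof.
move=> p0; apply/integrableP; split.
  by apply/measurable_EFinP; apply: measurable_funTS.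
under eq_integral do rewrite gee0_abs ?lee_fin ?powR_ge0//.
by rewrite integral_powR_itvoc// ltry.
Qed.

Lemma Rintegral_powR_itvoc p : 0 < p ->
  \int[mu]_(x in `]0, 1]) (x `^ (p - 1)) = p^-1.
Proof. by move=> p0; rewrite /Rintegral integral_powR_itvoc. Qed.

Lemma integrable_powR_itvoy p a : 0 < p -> 0 < a ->
  mu.-integrable `]a, +oo[ (fun x => (x `^ (- p - 1))%:E).
Proof.
move=> p0 a0; apply/integrableP; split.
  by apply/measurable_EFinP; apply: measurable_funTS.
under eq_integral do rewrite gee0_abs ?lee_fin ?powR_ge0//.
rewrite integral_itv_obnd_cbnd ?integral_powR_itvcy ?ltry//.
by apply/measurable_EFinP; apply: measurable_funTS.
Qed.

Lemma Rintegral_powR_itvoy p a : 0 < p -> 0 < a ->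
  \int[mu]_(x in `]a, +oo[) (x `^ (- p - 1)) = a `^ (- p) / p.
Proof.
move=> p0 a0; rewrite /Rintegral integral_itv_obnd_cbnd.
  by rewrite integral_powR_itvcy.
by apply/measurable_EFinP; apply: measurable_funTS.
Qed.

End powR_integrable.

(** * The peridynamic integral: integrability, small-c bounds, scaling, large-c limit *)

Section peridynamic_integral.
Context {R : realType}.
Notation mu := (@lebesgue_measure R).
Variable alpha : R.
Hypotheses (alpha_gt0 : 0 < alpha) (alpha_lt1 : alpha < 1).
Local Notation s := (1 + 2 * alpha).

Lemma measurable_onem_j0_div (c : R) : 0 < c ->
  measurable_fun (`]0, +oo[ : set R) (fun x => (1 - j0 (c * x)) / x `^ s).
Proof.
(* On the positive half-line the case split in [j0] disappears and the quotients become powers,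
   which gives a product of functions measurable on the whole line. *)
move=> c0; apply: (eq_measurable_fun
    (fun x => (1 - sin (c * x) * (c * x) `^ (- 1)) * x `^ (- s))) => [x|].
  rewrite inE/= in_itv/= andbT => x0.
  by rewrite /j0 gt_eqF ?mulr_gt0// powR_inv1 ?powRN// ltW// mulr_gt0.
have mc : measurable_fun [set: R] ( *%R c) by exact: mulrl_measurable.
apply: measurable_funTS; apply: measurable_funM => //.
apply: measurable_funB => //; apply: measurable_funM.
  apply: (measurableT_comp _ mc).
  by apply: continuous_measurable_fun; exact: continuous_sin.
exact: (measurableT_comp (measurable_powR (-1)) mc).
Qed.

Lemma onem_j0_div_ge0 (c x : R) : 0 < c -> 0 < x ->
  0 <= (1 - j0 (c * x)) / x `^ s.
Proof.
by move=> c0 x0; rewrite divr_ge0 ?powR_ge0// onem_j0_ge0// mulr_gt0.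
Qed.

(** The quadratic bound divided by x^s has exponent 2 - s, written as p - 1 with p = 2(1 - alpha) to
    fit the power integrals on ]0, 1]; alpha < 1 makes p positive. The quartic term of
    [onem_j0_div_ge] likewise has p = 2(2 - alpha). *)
Lemma onem_j0_div_le (c x : R) : 0 < c -> 0 < x ->
  (1 - j0 (c * x)) / x `^ s <= c ^+ 2 / 6 * x `^ (2 * (1 - alpha) - 1).
Proof.
move=> c0 x0; rewrite ler_pdivrMr ?powR_gt0//.
rewrite -(mulrA (c ^+ 2 / 6)) -powRD; last by rewrite (gt_eqF x0) implybT.
have -> : 2 * (1 - alpha) - 1 + s = 2%:R by lra.
rewrite powR_mulrn ?(ltW x0)//.
by have := onem_j0_le (mulr_gt0 c0 x0); rewrite exprMn; lra.
Qed.

Lemma onem_j0_div_ge (c x : R) : 0 < c -> 0 < x ->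
  c ^+ 2 / 6 * x `^ (2 * (1 - alpha) - 1) -
  c ^+ 4 / 120 * x `^ (2 * (2 - alpha) - 1) <= (1 - j0 (c * x)) / x `^ s.
Proof.
move=> c0 x0; rewrite ler_pdivlMr ?powR_gt0//.
rewrite mulrBl -(mulrA (c ^+ 2 / 6)) -(mulrA (c ^+ 4 / 120)) -!powRD; try by rewrite (gt_eqF x0) implybT.
have -> : 2 * (1 - alpha) - 1 + s = 2%:R by lra.
have -> : 2 * (2 - alpha) - 1 + s = 4%:R by lra.
rewrite !powR_mulrn ?(ltW x0)//.
by have := onem_j0_ge (mulr_gt0 c0 x0); rewrite !exprMn; lra.
Qed.

(** Here -s takes the form -p - 1 with p = 2 alpha, the shape of the power integrals at infinity. *)
Lemma onem_j0_div_le2 (x : R) : 0 < x ->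
  (1 - j0 x) / x `^ s <= 2 * x `^ (- (2 * alpha) - 1).
Proof.
move=> x0; rewrite -opprD [_ + 1]addrC powRN.
by rewrite ler_wpM2r ?invr_ge0 ?powR_ge0// onem_j0_le2.
Qed.

Lemma integrable_onem_j0_div_itvoc (c : R) : 0 < c ->
  mu.-integrable `]0, 1] (fun x => ((1 - j0 (c * x)) / x `^ s)%:E).
Proof.
move=> c0.
have p0 : 0 < 2 * (1 - alpha) by rewrite mulr_gt0// subr_gt0.
apply: (le_integrable _ _ _ (integrableZl _ (c ^+ 2 / 6)
  (integrable_powR_itvoc p0))) => //.
- apply/measurable_EFinP; apply: measurable_funS (measurable_onem_j0_div c0) => //.
  exact: subset_itvl.
- move=> x; rewrite /= in_itv/= => /andP[x0 _].
  rewrite ger0_norm ?onem_j0_div_ge0// ger0_norm.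
    by rewrite lee_fin onem_j0_div_le.
  by rewrite mulr_ge0 ?powR_ge0// divr_ge0 ?sqr_ge0.
Qed.

(** Split at 1: on ]0, 1] the quadratic bound dominates, which uses alpha < 1; beyond 1 the bound 1
    - j0 <= 2 dominates, which uses alpha > 0. *)
Lemma integrable_onem_j0_div :
  mu.-integrable `]0, +oo[ (fun x => ((1 - j0 x) / x `^ s)%:E).
Proof.
have mF : measurable_fun (`]0, +oo[ : set R) (fun x => (1 - j0 x) / x `^ s).
  apply: eq_measurable_fun (measurable_onem_j0_div ltr01) => x _.
  by rewrite mul1r.
rewrite (@itv_bndbnd_setU _ _ _ (BRight 1)) ?bnd_simp//.
apply: integrable_setU => //.
- apply/eqP/seteqP; split => x //=; rewrite !in_itv/= andbT.
  by move=> [/andP[_ x1] /(le_lt_trans x1)]; rewrite ltxx.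
- apply: eq_integrable (integrable_onem_j0_div_itvoc ltr01) => // x _.
  by rewrite mul1r.
- have p0 : 0 < 2 * alpha by rewrite mulr_gt0.
  apply: (le_integrable _ _ _ (integrableZl _ 2
    (integrable_powR_itvoy p0 ltr01))) => //.
  + apply/measurable_EFinP; apply: measurable_funS mF => //.
    by apply: subset_itvr; rewrite bnd_simp.
  + move=> x; rewrite /= in_itv/= andbT => x1.
    have x0 : 0 < x by exact: lt_trans x1.
    have := onem_j0_div_ge0 ltr01 x0; rewrite mul1r => ?.
    rewrite ger0_norm// ger0_norm ?mulr_ge0 ?powR_ge0//.
    by rewrite lee_fin onem_j0_div_le2.
Qed.

(** The 12 is the Taylor denominator 6 times the 2 in the integral 1/(2(1 - alpha)) of the power; in
    the lower bound that follows, 240 is 120 times 2 in the same way. *)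
Lemma Rintegral_onem_j0_div_le (c : R) : 0 < c ->
  \int[mu]_(x in `]0, 1]) ((1 - j0 (c * x)) / x `^ s) <=
  c ^+ 2 / (12 * (1 - alpha)).
Proof.
move=> c0.
have p0 : 0 < 2 * (1 - alpha) by rewrite mulr_gt0// subr_gt0.
have -> : c ^+ 2 / (12 * (1 - alpha)) =
    \int[mu]_(x in `]0, 1]) (c ^+ 2 / 6 * x `^ (2 * (1 - alpha) - 1)).
  rewrite RintegralZl ?Rintegral_powR_itvoc//.
    by field; rewrite gt_eqF// subr_gt0.
  exact: integrable_powR_itvoc.
apply: le_Rintegral => //.
- exact: integrable_onem_j0_div_itvoc.
- exact: (integrableZl _ _ (integrable_powR_itvoc p0)).
- by move=> x; rewrite /= in_itv/= => /andP[x0 _]; exact: onem_j0_div_le.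
Qed.

Lemma Rintegral_onem_j0_div_ge (c : R) : 0 < c ->
  c ^+ 2 / (12 * (1 - alpha)) - c ^+ 4 / (240 * (2 - alpha)) <=
  \int[mu]_(x in `]0, 1]) ((1 - j0 (c * x)) / x `^ s).
Proof.
move=> c0.
have p0 : 0 < 2 * (1 - alpha) by rewrite mulr_gt0// subr_gt0.
have a2 : 0 < 2 - alpha by rewrite subr_gt0 (lt_trans alpha_lt1)// ltr1n.
have q0 : 0 < 2 * (2 - alpha) by rewrite mulr_gt0.
have ip : mu.-integrable `]0, 1]
    (fun x => (c ^+ 2 / 6 * x `^ (2 * (1 - alpha) - 1))%:E).
  exact: (integrableZl _ _ (integrable_powR_itvoc p0)).
have iq : mu.-integrable `]0, 1]
    (fun x => (c ^+ 4 / 120 * x `^ (2 * (2 - alpha) - 1))%:E).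
  exact: (integrableZl _ _ (integrable_powR_itvoc q0)).
have -> : c ^+ 2 / (12 * (1 - alpha)) - c ^+ 4 / (240 * (2 - alpha)) =
    \int[mu]_(x in `]0, 1]) (c ^+ 2 / 6 * x `^ (2 * (1 - alpha) - 1) -
                             c ^+ 4 / 120 * x `^ (2 * (2 - alpha) - 1)).
  rewrite RintegralB//.
  rewrite !RintegralZl ?Rintegral_powR_itvoc//; try exact: integrable_powR_itvoc.
  by field; rewrite !gt_eqF// subr_gt0.
apply: le_Rintegral => //.
- exact: (integrableB _ ip iq).
- exact: integrable_onem_j0_div_itvoc.
- by move=> x; rewrite /= in_itv/= => /andP[x0 _]; exact: onem_j0_div_ge.
Qed.

Lemma Rintegral_onem_j0_div_scale (c : R) : 0 < c ->
  \int[mu]_(x in `]0, 1]) ((1 - j0 (c * x)) / x `^ s) =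
  c `^ (2 * alpha) * \int[mu]_(x in `]0, c]) ((1 - j0 x) / x `^ s).
Proof.
move=> c0.
have iF : mu.-integrable `]0, c] (fun x => ((1 - j0 x) / x `^ s)%:E).
  by apply: integrableS integrable_onem_j0_div => //; exact: subset_itvl.
have := @ge0_integral_scale _ c `]0, c]%classic
  (fun x => ((1 - j0 x) / x `^ s)%:E) c0 (measurable_itv _) (measurable_int _ iF).
have -> : ( *%R c @^-1` `]0, c] = `]0, 1])%classic.
  rewrite eqEsubset; split => x/=; rewrite !in_itv/= pmulr_rgt0//;
    by rewrite -ler_pdivlMl// mulVf ?gt_eqF.
move=> scaleE.
have {}scaleE : \int[mu]_(x in `]0, 1]) ((1 - j0 (c * x)) / (c * x) `^ s) =
    c^-1 * \int[mu]_(x in `]0, c]) ((1 - j0 x) / x `^ s).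
  rewrite /Rintegral scaleE ?fineM//; first exact: integrable_fin_num.
  move=> x; rewrite /= in_itv/= => /andP[x0 _].
  by have := onem_j0_div_ge0 ltr01 x0; rewrite mul1r lee_fin.
(* The factor c^s comes from replacing x^s by (c x)^s in the denominator, and 1/c from the change of
   variables. *)
have -> : c `^ (2 * alpha) = c `^ s * c^-1.
  by rewrite -powR_inv1 ?ltW// -powRD ?(gt_eqF c0) ?implybT//; congr powR; lra.
have csn0 : c `^ s != 0 by rewrite gt_eqF// powR_gt0.
rewrite -mulrA -scaleE -RintegralZl//.
  apply: eq_Rintegral => x; rewrite inE/= in_itv/= => /andP[x0 _].
  by rewrite powRM ?ltW// invfM mulrCA !mulrA mulfK.
apply: eq_integrable (integrableZl _ (c `^ s)^-1
  (integrable_onem_j0_div_itvoc c0)) => // x.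
rewrite inE/= in_itv/= => /andP[x0 _].
by rewrite -EFinM powRM ?ltW// invfM mulrCA.
Qed.

Lemma Rintegral_onem_j0_div_cvgy :
  \int[mu]_(x in `]0, c]) ((1 - j0 x) / x `^ s) @[c --> +oo] -->
  \int[mu]_(x in `]0, +oo[) ((1 - j0 x) / x `^ s).
Proof.
have p0 : 0 < 2 * alpha by rewrite mulr_gt0.
pose Ioo := \int[mu]_(x in `]0, +oo[) ((1 - j0 x) / x `^ s).
(* The lower barrier subtracts the bound on the tail: twice the integral of x^(-2 alpha - 1) over
   ]c, +oo[, that is 2 c^(-2 alpha) / (2 alpha). The upper barrier holds because the tail is
   nonnegative. *)
apply: (@squeeze_cvgr _ _ _ _ (fun c => Ioo - c `^ (- (2 * alpha)) / alpha)
  (cst Ioo)); last 2 first.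
- rewrite -[X in _ --> X]subr0; apply: cvgB; first exact: cvg_cst.
  by rewrite -(mul0r alpha^-1); apply: cvgMr_tmp; exact: powRN_cvgy.
- exact: cvg_cst.
near=> c.
have c0 : 0 < c by near: c; exact: nbhs_pinfty_gt.
have := @Rintegral_itvB _ _ (BRight 0) +oo%O c integrable_onem_j0_div.
rewrite !bnd_simp => /(_ (ltW c0) isT) tailE.
have i_tail : mu.-integrable `]c, +oo[ (fun x => ((1 - j0 x) / x `^ s)%:E).
  apply: integrableS integrable_onem_j0_div => //.
  by apply: subset_itvr; rewrite bnd_simp ltW.
have tail_ge0 : 0 <= \int[mu]_(x in `]c, +oo[) ((1 - j0 x) / x `^ s).
  apply: Rintegral_ge0 => x; rewrite /= in_itv/= andbT => cx.
  by have := onem_j0_div_ge0 ltr01 (lt_trans c0 cx); rewrite mul1r.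
have : \int[mu]_(x in `]c, +oo[) ((1 - j0 x) / x `^ s) <=
    \int[mu]_(x in `]c, +oo[) (2 * x `^ (- (2 * alpha) - 1)).
  apply: le_Rintegral => //.
    exact: (integrableZl _ _ (integrable_powR_itvoy p0 c0)).
  move=> x; rewrite /= in_itv/= andbT => cx.
  by apply: onem_j0_div_le2; exact: lt_trans cx.
rewrite RintegralZl ?Rintegral_powR_itvoy//; last exact: integrable_powR_itvoy.
have -> : 2 * (c `^ (- (2 * alpha)) / (2 * alpha)) = c `^ (- (2 * alpha)) / alpha.
  by field; rewrite gt_eqF.
by move: tail_ge0; rewrite -tailE -/Ioo /cst; lra.
Unshelve. all: by end_near. Qed.

End peridynamic_integral.

(** * The dispersion relation and its two limits *)

Lemma omega_sqr (R : realType) (kappa rho delta alpha xi : R) :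
  0 < kappa -> 0 < rho -> 0 < delta -> 0 < xi ->
  omega kappa rho delta alpha xi ^+ 2 =
  8 * pi * kappa / (rho * delta `^ (2 * alpha)) *
  \int[lebesgue_measure]_(z in `]0, 1])
     ((1 - j0 (xi * delta * z)) / z `^ (1 + 2 * alpha)).
Proof.
(* [Num.sqrt] is 0 on negative arguments, so squaring recovers the radicand only once it is known to
   be nonnegative. *)
move=> kappa_gt0 rho_gt0 delta_gt0 xi_gt0; rewrite /omega sqr_sqrtr//.
apply: mulr_ge0.
  by rewrite divr_ge0 ?mulr_ge0 ?pi_ge0 ?powR_ge0// ltW.
apply: Rintegral_ge0 => z; rewrite /= in_itv/= => /andP[z_gt0 _].
by rewrite onem_j0_div_ge0// mulr_gt0.
Qed.

Theorem theorem3p2 (R : realType) (kappa rho delta alpha : R)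
    (kappa_gt0 : 0 < kappa) (rho_gt0 : 0 < rho) (delta_gt0 : 0 < delta)
    (alpha_gt0 : 0 < alpha) (alpha_lt1 : alpha < 1) :
  (xi ^- 2 * omega kappa rho delta alpha xi ^+ 2 @[xi --> 0^'+] -->
     2 * pi * kappa * delta `^ (2 * (1 - alpha)) / (3 * (1 - alpha) * rho)) /\
  (xi `^ (- (2 * alpha)) * omega kappa rho delta alpha xi ^+ 2
     @[xi --> +oo] -->
     8 * pi * kappa / rho *
     \int[lebesgue_measure]_(tau in `]0, +oo[)
        ((1 - j0 tau) / tau `^ (1 + 2 * alpha))).
Proof.
have pi_gt0 := @pi_gt0 R.
have dpow_gt0 : 0 < delta `^ (2 * alpha) by exact: powR_gt0.
split.
- have onem_gt0 : 0 < 1 - alpha by rewrite subr_gt0.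
  have twom_gt0 : 0 < 2 - alpha by lra.
  pose K := 8 * pi * kappa / (rho * delta `^ (2 * alpha)).
  have K_ge0 : 0 <= K by rewrite divr_ge0 ?mulr_ge0// ltW.
  (* The stated constant is the prefactor [K] times the leading coefficient in c = xi delta: 8/12 =
     2/3, and delta^2 over delta^(2 alpha) gives the power of delta. *)
  have -> : 2 * pi * kappa * delta `^ (2 * (1 - alpha)) /
      (3 * (1 - alpha) * rho) = K * (delta ^+ 2 / (12 * (1 - alpha))).
    have -> : delta `^ (2 * (1 - alpha)) = delta ^+ 2 / delta `^ (2 * alpha).
      rewrite -powR_mulrn ?ltW// -powRB ?(gt_eqF delta_gt0) ?implybT//.
      by congr powR; lra.
    by rewrite /K; field; rewrite !gt_eqF.
  (* [B] collects the quartic error: after division by xi^2 it contributes [B * xi ^+ 2], which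
     tends to 0. *)
  pose B := K * (delta ^+ 4 / (240 * (2 - alpha))).
  apply: (@squeeze_cvgr _ _ _ _
    (fun xi => K * (delta ^+ 2 / (12 * (1 - alpha))) - B * xi ^+ 2)
    (cst (K * (delta ^+ 2 / (12 * (1 - alpha)))))); last 2 first.
  + rewrite -[X in _ --> X]subr0 -[X in _ --> _ - X](mulr0 B).
    apply: cvg_at_right_filter; apply: cvgB; first exact: cvg_cst.
    apply: cvgMl_tmp; rewrite -[X in _ --> X](expr0n R 2).
    exact: (@exprn_continuous R 2 0).
  + exact: cvg_cst.
  near=> xi.
  have xi_gt0 : 0 < xi by [].
  have c_gt0 : 0 < xi * delta by rewrite mulr_gt0.
  rewrite omega_sqr// -/K [_ ^- 2 * _]mulrCA /cst /B.
  rewrite -[K * _ * xi ^+ 2]mulrA -mulrBr; apply/andP; split.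
    apply: ler_wpM2l => //; rewrite ler_pdivlMl ?exprn_gt0//.
    have := Rintegral_onem_j0_div_ge alpha_lt1 c_gt0; rewrite !exprMn.
    by apply: le_trans; rewrite le_eqVlt; apply/predU1P; left; field; rewrite !gt_eqF.
  apply: ler_wpM2l => //; rewrite ler_pdivrMl ?exprn_gt0//.
  apply: le_trans (Rintegral_onem_j0_div_le alpha_lt1 c_gt0) _.
  by rewrite exprMn -mulrA.
- have c_cvgy : xi * delta @[xi --> +oo] --> +oo.
    apply/cvgryPge => r; by near=> xi; rewrite -ler_pdivrMr.
  have := cvg_comp _ _ c_cvgy (Rintegral_onem_j0_div_cvgy alpha_gt0 alpha_lt1).
  move=> /(@cvgMl_tmp _ _ _ _ _ (8 * pi * kappa / rho)).
  apply: cvg_trans.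
  (* For positive xi the two functions are equal: the factor (xi delta)^(2 alpha) from scaling
     cancels both xi^(-2 alpha) and the delta^(2 alpha) in the prefactor, leaving the integral over
     ]0, xi delta]. *)
  apply: near_eq_cvg; near=> xi.
  have xi_gt0 : 0 < xi by [].
  have c_gt0 : 0 < xi * delta by rewrite mulr_gt0.
  rewrite /= omega_sqr// Rintegral_onem_j0_div_scale//.
  rewrite powRM ?ltW// powRN.
  field.
  by rewrite !gt_eqF// powR_gt0.
Unshelve. all: by end_near. Qed.
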